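(* Let $(X,\operatorname{dist})$ be a reflexive $\mathrm{CAT}(0)$-space, regarded as a subset of $W_p(X)$ via $x\mapsto\delta_x$. Then $\operatorname{reach}(X\subset W_p(X))=\infty$ for every $p>1$.
   Context: $\mathrm{CAT}(0)$: a complete metric space $(X,\operatorname{dist})$ is $\mathrm{CAT}(0)$ if for all $y,z\in X$ there exists $m\in X$ such that for all $x\in X$, $\operatorname{dist}(x,m)^2\le\frac{\operatorname{dist}(x,y)^2+\operatorname{dist}(x,z)^2}{2}-\frac{\operatorname{dist}(y,z)^2}{4}$. Reflexive: a metric space $X$ is reflexive if for every directed set $I$ and every non-increasing family $\{C_i\}_{i\in I}$ of non-empty bounded closed convex subsets of $X$ (i.e. $C_i\subset C_j$ whenever $i\ge j$), $\bigcap_{i\in I}C_i\ne\emptyset$. (A subset is convex if it contains every minimizing geodesic between any two of its points.) Wasserstein space: for $p\ge 1$, $\mathcal P_p(X)$ is the set of probability measures $\mu$ on $X$ with $\int_X \operatorname{dist}(x,x_0)^p\,d\mu(x)<\infty$ for some $x_0\in X$; $W_p(\mu,\nu)=\left(\inf_{\pi}\int_{X\times X}\operatorname{dist}(x,y)^p\,d\pi(x,y)\right)^{1/p}$, the infimum over probability measures $\pi$ on $X\times X$ with marginals $\mu,\nu$; $W_p(X)=(\mathcal P_p(X),W_p)$. The map $x\mapsto\delta_x$ is an isometric embedding. Reach: for a metric space $(Y,d)$ and $A\subset Y$, $\operatorname{Unp}(A)=\{y\in Y:\text{there exists a unique } a\in A \text{ with } d(y,A)=d(y,a)\}$; for $a\in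 A$, $\operatorname{reach}(a,A\subset Y)=\sup\{r\ge 0: B_r(a)\subset\operatorname{Unp}(A)\}$; $\operatorname{reach}(A\subset Y)=\inf_{a\in A}\operatorname{reach}(a,A\subset Y)$. *)

(* Defs.v *)
From HB Require Import structures.
From mathcomp Require Import all_boot all_order all_algebra generic_quotient.
From mathcomp Require Import lra.
From mathcomp Require Import all_classical all_reals all_analysis.
From mathcomp Require Import measurable_realfun.

Set Implicit Arguments.
Unset Strict Implicit.
Unset Printing Implicit Defensive.
Import Order.TTheory GRing.Theory Num.Theory.
Import numFieldNormedType.Exports.

Local Open Scope classical_set_scope.
Local Open Scope ring_scope.

(* Being a completeType, such a space is pointed, hence nonempty. *)
#[short(type="completeMetricType")]
HB.structure Definition CompleteMetric (R : numDomainType) :=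
  {T of Complete T & Metric R T}.

Section metric_geometry.
Context (R : realType) (X : metricType R).
Implicit Types (C : set X) (y z : X).

Lemma continuous_mdist z : continuous (fun y => mdist y z).
Proof.
move=> y; apply/cvgrPdist_lt => e e0.
near=> t.
have : ball y e t by near: t; exact: nbhsx_ballx.
rewrite ballEmdist/= => yte; rewrite (le_lt_trans _ yte)// ler_norml.
have := metric_triangle y t z; have := metric_triangle t y z.
by rewrite (metric_sym t y) => *; apply/andP; split; lra.
Unshelve. all: by end_near. Qed.

(* The completeness in the definition of a CAT(0) space is not part of this
   predicate: it is carried by completeMetricType. *)
Definition CAT0 : Prop :=
  forall y z, exists m, forall x,
    mdist x m ^+ 2 <=
      (mdist x y ^+ 2 + mdist x z ^+ 2) / 2 - mdist y z ^+ 2 / 4.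

(* Minimizing geodesics are parametrized on [0, 1] with constant speed; the
   values of g outside [0, 1] are irrelevant. *)
Definition min_geodesic (g : R -> X) y z : Prop :=
  [/\ g 0 = y, g 1 = z &
      {in `[0, 1] &, forall s t, mdist (g s) (g t) = `|s - t| * mdist y z}].

Definition geodesically_convex C : Prop :=
  forall y z g, C y -> C z -> min_geodesic g y z -> g @` `[0, 1] `<=` C.

Definition metric_bounded C : Prop := exists x r, C `<=` ball x r.

Definition directed_order (I : Type) (le : I -> I -> Prop) : Prop :=
  [/\ inhabited I, forall i, le i i,
      forall i j k, le i j -> le j k -> le i k &
      forall i j, exists k, le i k /\ le j k].

Definition reflexive_space : Prop :=
  forall (I : Type) (le : I -> I -> Prop) (C : I -> set X),
    directed_order le ->
    (forall i, [/\ C i !=set0, metric_bounded (C i), closed (C i) &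
                   geodesically_convex (C i)]) ->
    (forall i j, le j i -> C i `<=` C j) ->
    \bigcap_i C i !=set0.

End metric_geometry.
Arguments CAT0 {R} X.
Arguments reflexive_space {R} X.

(* The distance is allowed to be extended-real-valued, so that the
   Wasserstein distance can be plugged in without first proving it finite. *)
Section reach.
Local Open Scope ereal_scope.
Context (R : realType) (Y : Type) (d : Y -> Y -> \bar R).
Implicit Types (A : set Y) (a y : Y).

Definition set_dist y A : \bar R := ereal_inf [set d y a | a in A].

Definition Unp A : set Y :=
  [set y | exists! a, A a /\ set_dist y A = d y a].

Definition reach_at a A : \bar R :=
  ereal_sup [set r%:E | r in
    [set r : R | (0 <= r)%R /\ [set y | d a y < r%:E] `<=` Unp A]].

Definition reach A : \bar R := ereal_inf [set reach_at a A | a in A].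

End reach.

(* Makes products of ptopologicalType instances of ptopologicalType. *)
HB.saturate prod.

Definition borel (T : ptopologicalType) := g_sigma_algebraType (@open T).

Lemma continuous_borel_measurable (R : realType) (T : ptopologicalType)
  (f : T -> R) : continuous f -> measurable_fun [set: borel T] (f : borel T -> R).
Proof.
move=> /continuousP cf.
apply: (measurability _ (RGenOpens.measurableE R)) => _ [_ [a [b ->] <-]].
by rewrite setTI; apply: sub_sigma_algebra; apply: cf; exact: interval_open.
Qed.

(* A probability of MathComp-Analysis is a function on all sets, whose values
   on non-measurable sets are arbitrary; two of them are the same Borel
   probability measure when they agree on Borel sets. *)
Section borel_probability.
Context (R : realType) (T : ptopologicalType).

HB.instance Definition _ := gen_eqMixin (probability (borel T) R).
HB.instance Definition _ := gen_choiceMixin (probability (borel T) R).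

Definition eq_borel (mu nu : probability (borel T) R) : bool :=
  `[< forall A : set (borel T), measurable A -> mu A = nu A >].

Let eq_borel_refl : reflexive eq_borel.
Proof. by move=> mu; apply/asboolP. Qed.

Let eq_borel_sym : symmetric eq_borel.
Proof.
by move=> mu nu; apply/idP/idP => /asboolP h; apply/asboolP => A mA;
  rewrite h.
Qed.

Let eq_borel_trans : transitive eq_borel.
Proof.
by move=> mu nu la /asboolP h /asboolP k; apply/asboolP => A mA; rewrite h// k.
Qed.

Canonical eq_borel_canonical :=
  EquivRel eq_borel eq_borel_refl eq_borel_sym eq_borel_trans.

Local Open Scope quotient_scope.

Definition borel_prob : Type := {eq_quot eq_borel}.
HB.instance Definition _ := Choice.on borel_prob.
HB.instance Definition _ := EqQuotient.on borel_prob.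

Definition prob_of_borel (mu : borel_prob) : probability (borel T) R := repr mu.
Coercion prob_of_borel : borel_prob >-> probability.

Definition borel_of_prob (mu : probability (borel T) R) : borel_prob :=
  \pi_borel_prob mu.

Lemma borel_of_probE (mu : probability (borel T) R) (A : set (borel T)) :
  measurable A -> borel_of_prob mu A = mu A.
Proof.
move=> mA.
have /eqP := reprK (borel_of_prob mu).
by rewrite eqmodE => /asboolP; exact.
Qed.

Lemma borel_probP (mu nu : borel_prob) :
  (forall A : set (borel T), measurable A -> mu A = nu A) -> mu = nu.
Proof.
move=> h; rewrite -[mu]reprK -[nu]reprK; apply/eqP; rewrite eqmodE.
exact/asboolP.
Qed.

End borel_probability.

Section wasserstein.
Local Open Scope ereal_scope.
Context (R : realType) (X : completeMetricType R) (p : R).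

Definition finite_moment (mu : borel_prob R X) : Prop :=
  exists x0 : X, \int[mu]_x ((mdist (x : X) x0) `^ p)%:E < +oo.

Definition wspace : Type := {mu : borel_prob R X | finite_moment mu}.

(* Couplings live on the Borel sigma-algebra of the product space, which for
   a nonseparable X may be larger than the product sigma-algebra. *)
Definition couplings (mu nu : borel_prob R X) :
    set (probability (borel (X * X)%type) R) :=
  [set pi | forall A : set (borel X), measurable A ->
     pi (A `*` setT) = mu A /\ pi (setT `*` A) = nu A].

Definition wdist (mu nu : wspace) : \bar R :=
  (ereal_inf [set \int[pi]_z (mdist (z : X * X).1 (z : X * X).2 `^ p)%:E
             | pi in couplings (sval mu) (sval nu)]) `^ p^-1.

Lemma finite_moment_dirac (x : X) :
  finite_moment (borel_of_prob (\d_(x : borel X))).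
Proof.
exists x; rewrite (eq_measure_integral (\d_(x : borel X))); last first.
  by move=> A mA _; exact: borel_of_probE.
rewrite integral_dirac ?mdistxx//= ?diracT ?mul1e ?ltry//.
apply/measurable_EFinP; apply: (measurableT_comp (measurable_powR p)).
exact: (continuous_borel_measurable (@continuous_mdist R X x)).
Qed.

Definition wdirac (x : X) : wspace := exist _ _ (finite_moment_dirac x).

End wasserstein.

(* Main.v *)
Require Import Defs.
From mathcomp Require Import all_boot all_order all_algebra.
From mathcomp Require Import ring lra.
From mathcomp Require Import all_classical all_reals all_analysis.
From mathcomp Require Import measurable_realfun.

(** The only coupling of mu with the Dirac mass at x is carried by X * {x}, so
    the Wasserstein distance from mu to it is the L^p norm of the distance to x
    under mu.  By Minkowski's inequality the sublevel sets of this function of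
    x are closed and bounded.  For p > 1 the CAT(0) inequality and the strict
    convexity of t |-> t ^ p give d(w, m)^p < (d(w, y)^p + d(w, z)^p) / 2 for
    every w when m is the midpoint of y <> z.  Hence the sublevel sets are
    geodesically convex, reflexivity gives them a common point, which is a
    minimizer, and the minimizer is unique: every mu has a unique nearest
    point in X. *)

Set Implicit Arguments.
Unset Strict Implicit.
Unset Printing Implicit Defensive.
Import Order.TTheory GRing.Theory Num.Theory.
Import numFieldNormedType.Exports.

Local Open Scope classical_set_scope.
Local Open Scope ring_scope.

(** * Strict convexity of the power function *)

Section power.
Context (R : realType).
Implicit Types a b p u : R.

(** For [u > 0] and [s = ln u], [u ^ p = u exp((p - 1) s) > u (1 + (p - 1) s)], while
    [exp(- s) >= 1 - s] gives [u s >= u - 1]. *)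
Lemma powR_Bernoulli_lt p u : 1 < p -> 0 <= u -> u != 1 ->
  1 + p * (u - 1) < u `^ p.
Proof.
move=> p1; rewrite le_eqVlt => /predU1P[<- _|u0 u1].
  by rewrite powR0; [lra | apply/eqP; lra].
rewrite /powR gt_eqF//; set s := ln u.
have us : expR s = u by rewrite /s lnK.
have s0 : s != 0 by rewrite ln_eq0.
have h1 : u * (1 + (p - 1) * s) < expR (p * s).
  have -> : p * s = s + (p - 1) * s by ring.
  rewrite expRD us ltr_pM2l// expR_gt1Dx// mulf_neq0//.
  by apply/eqP; lra.
have h2 : u * (1 - s) <= 1.
  have uV : u * expR (- s) = 1 by rewrite -us -expRD subrr expR0.
  by rewrite -[leRHS]uV ler_pM2l// expR_ge1Dx.
have : (p - 1) * (u * (1 - s)) <= p - 1 by rewrite ler_piMr// ; lra.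
lra.
Qed.

Lemma powR_tangent_lt p m x : 1 < p -> 0 < m -> 0 <= x -> x != m ->
  m `^ p * (1 + p * (x / m - 1)) < x `^ p.
Proof.
move=> p1 m0 x0 xm; rewrite -[in ltRHS](divfK (lt0r_neq0 m0) x).
rewrite powRM ?divr_ge0 ?(ltW m0)// [ltRHS]mulrC ltr_pM2l ?powR_gt0//.
apply: powR_Bernoulli_lt; rewrite ?divr_ge0 ?(ltW m0)//.
by apply: contra xm => /eqP xm; rewrite -[x](divfK (lt0r_neq0 m0)) xm mul1r.
Qed.

(** The tangent at the midpoint lies strictly below both values, and its slope terms cancel in the
    sum. *)
Lemma powR_midpoint_lt p a b : 1 < p -> 0 <= a -> 0 <= b -> a != b ->
  ((a + b) / 2) `^ p < (a `^ p + b `^ p) / 2.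
Proof.
move=> p1 a0 b0 ab; set m := (a + b) / 2.
have m0 : 0 < m.
  by rewrite /m; move/eqP: ab => ab; lra.
have := powR_tangent_lt p1 m0 a0; have := powR_tangent_lt p1 m0 b0.
have -> : b / m = 2 - a / m.
  by rewrite -[2](mulfK (lt0r_neq0 m0)) -mulrBl; congr (_ / _); rewrite /m; lra.
have -> : a != m by move/eqP: ab => ab; apply/eqP; rewrite /m; lra.
have -> : b != m by move/eqP: ab => ab; apply/eqP; rewrite /m; lra.
move=> /(_ isT) + /(_ isT); lra.
Qed.

End power.

(** * Midpoints and convex sets in CAT(0) spaces *)

Section midpoint.
Context (R : realType) (X : metricType R).
Implicit Types (C : set X) (x y z m : X).

Definition cat0_midpoint y z m := forall x,
  mdist x m ^+ 2 <= (mdist x y ^+ 2 + mdist x z ^+ 2) / 2 - mdist y z ^+ 2 / 4.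

(** Let [a], [b] be the distances from [x] to [y], [z]. If [a = b], the term in [mdist y z] makes
    the bound strict. Otherwise [|a - b| <= mdist y z] turns the CAT(0) bound into
    [mdist x m <= (a + b) / 2], and strict convexity applies. *)
Lemma cat0_midpoint_pow_lt (p : R) y z m x : 1 < p -> cat0_midpoint y z m ->
  y != z -> mdist x m `^ p < (mdist x y `^ p + mdist x z `^ p) / 2.
Proof.
move=> p1 /(_ x) ymz yz.
have yz0 : 0 < mdist y z by rewrite mdist_gt0.
have := metric_triangle y x z; have := metric_triangle x y z.
have := metric_triangle x z y.
rewrite (metric_sym z y) (metric_sym y x).
move: ymz yz0; have := mdist_ge0 x m; have := mdist_ge0 x y.
have := mdist_ge0 x z.
move: (mdist x m) (mdist x y) (mdist x z) (mdist y z) => d a b c.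
move=> b0 a0 d0 dabc c0 bac cab cab'.
have p0 : 0 <= p by lra.
have [ab|ab] := eqVneq a b.
  have da : d < a by rewrite ab in dabc *; nra.
  have -> : (a `^ p + b `^ p) / 2 = a `^ p by rewrite -ab; lra.
  by rewrite gt0_ltr_powR ?nnegrE//; lra.
apply: le_lt_trans (powR_midpoint_lt p1 a0 b0 ab).
rewrite ge0_ler_powR ?nnegrE//; first by lra.
by rewrite -(@ler_pXn2r _ 2) ?nnegrE//; [nra|lra].
Qed.

(** Tested at [w], the right-hand side of the CAT(0) inequality vanishes. *)
Lemma cat0_midpoint_unique y z m w : cat0_midpoint y z m ->
  mdist y w = mdist y z / 2 -> mdist w z = mdist y z / 2 -> w = m.
Proof.
move=> /(_ w) + yw wz; rewrite (metric_sym w y) yw wz => wm.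
apply: mdist_positivity; apply/eqP; rewrite -sqrf_eq0 eq_le sqr_ge0 andbT.
by apply: le_trans wm _; lra.
Qed.

(* Bisection: every parameter lies between two parameters of points of C that
   are at most (1 / 2) ^ n apart. *)
Lemma midpoint_closed_geodesically_convex C : CAT0 X -> closed C ->
  (forall y z m, C y -> C z -> cat0_midpoint y z m -> C m) ->
  geodesically_convex C.
Proof.
move=> cat cC mC y z g Cy Cz [g0 g1 gd] _ [t /= tI <-].
have /andP[t0 t1] : 0 <= t <= 1 by rewrite in_itv in tI.
have bisect n : exists u v, [/\ 0 <= u <= t, t <= v <= 1, C (g u), C (g v) &
    v - u <= 2^-1 ^+ n].
  elim: n => [|n [u [v [/andP[u0 ut] /andP[tv v1] Cu Cv uv]]]].
    exists 0, 1; rewrite g0 g1 expr0; split => //; lra.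
  pose w := (u + v) / 2.
  have Cw : C (g w).
    (* [g w] is halfway between [g u] and [g v], hence it is their CAT(0) midpoint. *)
    have [m gm] := cat (g u) (g v).
    rewrite (cat0_midpoint_unique (w := g w) gm); first exact: mC gm.
      rewrite !gd ?in_itv/= /w; [|lra..].
      by rewrite !ler0_norm; lra.
    rewrite !gd ?in_itv/= /w; [|lra..].
    by rewrite !ler0_norm; lra.
  rewrite exprS; have [tw|wt] := leP t w.
    by exists u, w; split => //; rewrite /w in tw *; lra.
  by exists w, v; split => //; rewrite /w in wt *; lra.
apply: cC => B /nbhs_ballP[e /= e0 eB].
have d0 := mdist_ge0 y z.
have [n ne] : exists n, 2^-1 ^+ n * (mdist y z + 1) < e.
  (* This choice gives [2 ^ k.+1 > k.+1 > (mdist y z + 1) / e]. *)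
  pose k := Num.truncn ((mdist y z + 1) / e).
  exists k.+1; rewrite exprVn mulrC ltr_pdivrMr ?exprn_gt0//.
  rewrite -ltr_pdivrMl// mulrC.
  apply: (lt_le_trans (truncnS_gt _)).
  by rewrite -natrX ler_nat -/k; apply/ltnW/ltn_expl.
have [u [v [/andP[u0 ut] /andP[tv v1] Cu Cv uv]]] := bisect n.
exists (g u); split=> //; apply: eB; rewrite ballEmdist/=.
rewrite gd ?in_itv/= ?t0//; last lra.
rewrite ger0_norm; last lra.
apply: le_lt_trans ne; apply: ler_pM => //; lra.
Qed.

End midpoint.

(** * Strict monotonicity of the integral and Minkowski's inequality *)

Section integral.
Context d (T : measurableType d) (R : realType).
Local Open Scope ereal_scope.

(** If the integrals agreed, [g - f] would vanish almost everywhere; as it is positive everywhere,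
    [setT] would be negligible. *)
Lemma lt_integral_EFin (mu : {measure set T -> \bar R}) (f g : T -> R) :
  mu setT != 0 -> measurable_fun setT f -> measurable_fun setT g ->
  (forall x, 0 <= f x)%R -> (forall x, f x < g x)%R ->
  \int[mu]_x (g x)%:E < +oo -> \int[mu]_x (f x)%:E < \int[mu]_x (g x)%:E.
Proof.
move=> muT mf mg f0 fg goo.
have mgf : measurable_fun setT (fun x => (g x - f x)%:E).
  by apply/measurable_EFinP; exact: measurable_funB.
have gf0 x : 0 <= (g x - f x)%:E by rewrite lee_fin subr_ge0 ltW.
have gE : \int[mu]_x (g x)%:E =
    \int[mu]_x (f x)%:E + \int[mu]_x (g x - f x)%:E.
  rewrite -ge0_integralD//; last 2 first.
    by move=> x _; rewrite lee_fin.
    exact/measurable_EFinP.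
  by apply: eq_integral => x _; rewrite -EFinD subrKC.
have fint0 : 0 <= \int[mu]_x (f x)%:E.
  by apply: integral_ge0 => x _; rewrite lee_fin.
have gfint0 : 0 <= \int[mu]_x (g x - f x)%:E by apply: integral_ge0.
have ffin : \int[mu]_x (f x)%:E \is a fin_num.
  rewrite ge0_fin_numE//; apply: le_lt_trans goo.
  by rewrite gE leeDl.
rewrite gE lteDl// lt_neqAle gfint0 andbT eq_sym; apply/eqP => gf.
have gf_ae : ae_eq mu setT (fun x => (g x - f x)%:E) (cst 0).
  apply/ae_eq_integral_abs => //; rewrite -[RHS]gf.
  by apply: eq_integral => x _; rewrite gee0_abs.
move/eqP: muT; apply; apply: measure_negligible => //.
apply: negligibleS gf_ae => x _ /= /(_ I) /eqP.
by rewrite eqe subr_eq0 gt_eqF.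
Qed.

(** Minkowski's inequality in the form that integrates a triangle inequality. *)
Lemma le_Lnorm_EFinD (mu : {measure set T -> \bar R}) (p : R) (f g h : T -> R) :
  (1 <= p)%R -> measurable_fun setT f -> measurable_fun setT g ->
  measurable_fun setT h -> (forall x, 0 <= h x <= f x + g x)%R ->
  'N[mu]_p%:E[EFin \o h] <= 'N[mu]_p%:E[EFin \o f] + 'N[mu]_p%:E[EFin \o g].
Proof.
move=> p1 mf mg mh hfg; apply: le_trans (minkowski_EFin _ mf mg p1).
have p0 : (0 <= p)%R by lra.
rewrite unlock; apply: gt0_ler_poweR; rewrite ?invr_ge0//.
- by rewrite in_itv/= leey andbT integral_ge0// => x _; exact: poweR_ge0.
- by rewrite in_itv/= leey andbT integral_ge0// => x _; exact: poweR_ge0.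
have mpow (k : T -> R) : measurable_fun setT k ->
    measurable_fun setT (fun x => `|(EFin \o k) x| `^ p).
  move=> mk; apply: (measurableT_comp (measurable_poweR p)).
  by apply: measurableT_comp => //; exact/measurable_EFinP.
apply: ge0_le_integral => //=.
- exact: mpow.
- exact/mpow/measurable_funD.
- move=> x _; have /andP[h0 hle] := hfg x.
  rewrite lee_fin ger0_norm// ger0_norm; last exact: le_trans hle.
  by rewrite ge0_ler_powR ?nnegrE// (le_trans h0).
Qed.

(** Lets the distance between two fixed points enter Minkowski's inequality as a norm. *)
Lemma Lnorm_cst (P : probability T R) (p c : R) : (0 < p)%R -> (0 <= c)%R ->
  'N[P]_p%:E[EFin \o cst c] = c%:E.
Proof.
move=> p0 c0; rewrite unlock.
rewrite /= ger0_norm// integral_cst//.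
have -> : (c `^ p)%:E * (P : {measure set T -> \bar R}) setT = (c `^ p)%:E.
  by rewrite -[RHS]mule1; congr (_ * _); exact: probability_setT.
rewrite poweR_EFin.
by rewrite -powRrM divff ?lt0r_neq0// powRr1.
Qed.

End integral.

(** * Borel measurability of the distance *)

Section borel.

Lemma continuous_measurable_borel (T U : ptopologicalType) (f : T -> U) :
  continuous f -> measurable_fun setT (f : borel T -> borel U).
Proof.
move=> /continuousP cf.
apply: (measurability (@open U : set (set (borel U))) erefl).
by move=> _ [B oB <-]; rewrite setTI; apply: sub_sigma_algebra; exact: cf.
Qed.

Context (R : realType) (X : completeMetricType R).

Lemma continuous_mdist2 : continuous (fun z : X * X => mdist z.1 z.2).
Proof.
move=> [a b]; apply/cvgrPdist_lt => e e0 /=.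
near=> z.
have [za zb] : ball a (e / 2) z.1 /\ ball b (e / 2) z.2.
  near: z; exists (ball a (e / 2), ball b (e / 2)) => //=.
    by split; apply: nbhsx_ballx; rewrite divr_gt0.
move: za zb; rewrite !ballEmdist/= ltr_norml => za zb.
have := metric_triangle a z.1 b; have := metric_triangle z.1 z.2 b.
have := metric_triangle z.1 a z.2; have := metric_triangle a b z.2.
rewrite (metric_sym z.1 a) (metric_sym z.2 b) => *.
by apply/andP; split; lra.
Unshelve. all: by end_near. Qed.

Lemma measurable_mdist (x : X) :
  measurable_fun setT (fun y : borel X => mdist (y : X) x).
Proof. exact: (continuous_borel_measurable (@continuous_mdist R X x)). Qed.

Lemma measurable_mdist2 : measurable_fun setT
  (fun z : borel (X * X)%type => mdist (z : X * X).1 (z : X * X).2).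
Proof. exact: (continuous_borel_measurable continuous_mdist2). Qed.

End borel.

(** * The Wasserstein distance to a Dirac mass *)

Section distance_to_dirac.
Context (R : realType) (X : completeMetricType R) (p : R).
Implicit Types (mu : borel_prob R X) (x y : X).
Local Open Scope ereal_scope.

Definition dist_norm mu x : \bar R :=
  'N[mu]_p%:E[EFin \o (fun y : borel X => mdist (y : X) x)].

Lemma dist_normE mu x :
  dist_norm mu x = (\int[mu]_y (mdist (y : X) x `^ p)%:E) `^ p^-1.
Proof.
rewrite /dist_norm unlock; congr (_ `^ _); apply: eq_integral => y _ /=.
by rewrite ger0_norm ?mdist_ge0.
Qed.

(** Almost surely [z.2 = x], so [z.2] may be replaced by [x]; what remains depends on [z.1] alone,
    whose law is [mu]. *)
Lemma integral_coupling_dirac mu x pi :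
  couplings mu (sval (wdirac p x)) pi ->
  \int[pi]_z (mdist (z : X * X).1 (z : X * X).2 `^ p)%:E =
  \int[mu]_y (mdist (y : X) x `^ p)%:E.
Proof.
move=> pic.
have mfst : measurable_fun setT (fst : borel (X * X)%type -> borel X).
  by apply: continuous_measurable_borel; move=> z; exact: cvg_fst.
have msnd : measurable_fun setT (snd : borel (X * X)%type -> borel X).
  by apply: continuous_measurable_borel; move=> z; exact: cvg_snd.
have mpow d (T : measurableType d) (f : T -> R) : measurable_fun setT f ->
    measurable_fun setT (fun z => (f z `^ p)%:E).
  move=> mf; apply/measurable_EFinP.
  exact: (measurableT_comp (measurable_powR p)).
(* Points are closed, so the second marginal can be evaluated on the complement of [x]. *)
have mx : measurable (~` [set x] : set (borel X)).
  apply: sub_sigma_algebra; apply: closed_openC.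
  apply: accessible_closed_set1; apply: hausdorff_accessible.
  exact: metric_hausdorff.
rewrite (@ge0_ae_eq_integral _ _ _ pi setT _
    (fun z => (mdist (z : X * X).1 x `^ p)%:E)) //.
- transitivity (\int[distribution pi (mfun_Sub (mem_set mfst))]_y
      (mdist (y : X) x `^ p)%:E).
    rewrite ge0_integral_distribution//.
      by apply: mpow; exact: measurable_mdist.
    by move=> y; rewrite lee_fin powR_ge0.
  apply: eq_measure_integral => A mA _; have [piA _] := pic A mA.
  rewrite /= -[RHS]piA /distribution /pushforward/=; congr (pi _).
  by apply/seteqP; split => z //= -[].
- by apply: mpow; exact: measurable_mdist2.
- by apply: mpow; exact: (measurableT_comp (measurable_mdist x)).
- by move=> z _; rewrite lee_fin powR_ge0.
- by move=> z _; rewrite lee_fin powR_ge0.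
(* The exceptional set has the mass that the Dirac measure at [x] gives to the complement of [x],
   namely 0. *)
exists (setT `*` ~` [set x]); split.
- rewrite (_ : _ `*` _ = snd @^-1` (~` [set x])); last first.
    by apply/seteqP; split => z //= -[].
  by rewrite -[_ @^-1` _]setTI; exact: msnd.
- have [_ pix] := pic _ mx.
  transitivity ((\d_(x : borel X) : probability _ R) (~` [set x])).
    by rewrite -[LHS]/(pi _) pix; exact: borel_of_probE.
  by rewrite /= diracE memNset//; apply.
- by move=> z /= h; split => // zx; apply: h => _; rewrite zx.
Qed.

(** The witness is the image of [mu] under [y |-> (y, x)]. Without a coupling the infimum would be
    [+oo]. *)
Lemma couplings_dirac_nonempty mu x :
  couplings mu (sval (wdirac p x)) !=set0.
Proof.
have mpair : measurable_fun setT
    ((fun y => (y, x)) : borel X -> borel (X * X)%type).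
  apply: (@continuous_measurable_borel X (X * X)%type) => y.
  by apply: cvg_pair => /=; [exact: cvg_id|exact: cvg_cst].
exists (distribution mu (mfun_Sub (mem_set mpair))) => A mA; split.
  rewrite /distribution /pushforward/=; congr (mu _).
  by apply/seteqP; split => [y []|].
rewrite borel_of_probE// /distribution /pushforward/= diracE.
have [Ax|Ax] := boolP (x \in A).
  rewrite -[RHS](probability_setT mu); congr (mu _).
  by apply/seteqP; split => // y _; split => //; exact: set_mem.
rewrite -[RHS](measure0 mu); congr (mu _).
by apply/seteqP; split => // y [_ /= /mem_set]; rewrite (negPf Ax).
Qed.

(** All couplings have the same cost, so the infimum is over a singleton. *)
Lemma wdist_dirac (mu : wspace X p) x :
  wdist mu (wdirac p x) = dist_norm (sval mu) x.
Proof.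
rewrite dist_normE /wdist; congr (_ `^ _); rewrite -[RHS]ereal_inf1.
congr ereal_inf; apply/seteqP; split => [_ [pi pic <-]|_ ->] /=.
  exact: integral_coupling_dirac.
have [pi pic] := couplings_dirac_nonempty (sval mu) x.
by exists pi => //; exact: integral_coupling_dirac.
Qed.

(** * Metric estimates and strict midpoint convexity of [dist_norm] *)

Hypothesis p1 : (1 < p)%R.

Let p0 : (0 < p)%R. Proof. exact: lt_trans ltr01 p1. Qed.

Lemma dist_norm_lipschitz mu x y :
  dist_norm mu x <= dist_norm mu y + (mdist y x)%:E.
Proof.
rewrite -(Lnorm_cst mu p0 (mdist_ge0 y x)).
apply: le_Lnorm_EFinD => //; [exact: ltW|exact: measurable_mdist..|].
by move=> z /=; rewrite mdist_ge0/=; exact: metric_triangle.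
Qed.

(** This makes the sublevel sets of [dist_norm] bounded. *)
Lemma mdist_le_dist_norm mu x y :
  (mdist x y)%:E <= dist_norm mu x + dist_norm mu y.
Proof.
rewrite -(Lnorm_cst mu p0 (mdist_ge0 x y)).
apply: le_Lnorm_EFinD => //; [exact: ltW|exact: measurable_mdist..|].
move=> z /=; rewrite mdist_ge0/= (metric_sym z x); exact: metric_triangle.
Qed.

(** The moment condition gives finiteness at one point, and the Lipschitz bound carries it to all
    others. *)
Lemma dist_norm_lty (mu : wspace X p) x : dist_norm (sval mu) x < +oo.
Proof.
have [x0 mux0] := svalP mu.
apply: le_lt_trans (dist_norm_lipschitz _ x x0) _.
by rewrite lte_add_pinfty ?ltry// dist_normE poweR_lty.
Qed.

(** The pointwise strict inequality between [p]-th powers is integrated; [c] is real, so the larger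
    integral is finite and strictness survives. *)
Lemma dist_norm_midpoint_lt mu x y m (c : R) : cat0_midpoint x y m -> x != y ->
  dist_norm mu x <= c%:E -> dist_norm mu y <= c%:E -> dist_norm mu m < c%:E.
Proof.
move=> xym xy.
have int_le z : dist_norm mu z <= c%:E ->
    \int[mu]_w (mdist (w : X) z `^ p)%:E <= (c `^ p)%:E.
  have i0 : 0 <= \int[mu]_w (mdist (w : X) z `^ p)%:E.
    by apply: integral_ge0 => w _; rewrite lee_fin powR_ge0.
  rewrite dist_normE => zc.
  (* The integral is rewritten as the [p]-th power of its [p]-th root. *)
  rewrite -[leLHS]poweRe1// -(mulVf (lt0r_neq0 p0)) poweRrM -poweR_EFin.
  apply: gt0_ler_poweR => //; rewrite ?ltW// in_itv/= leey andbT ?poweR_ge0//.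
  by apply: le_trans zc; exact: poweR_ge0.
have mpow z : measurable_fun setT (fun w : borel X =>
    (mdist (w : X) z `^ p)%R).
  exact: (measurableT_comp (measurable_powR p) (measurable_mdist z)).
move=> xc yc.
have c0 : (0 <= c)%R by rewrite -lee_fin (le_trans _ xc)// Lnorm_ge0.
have {}xc := int_le _ xc; have {}yc := int_le _ yc.
pose g (w : borel X) := ((mdist (w : X) x `^ p + mdist (w : X) y `^ p) / 2)%R.
have mg : measurable_fun setT g.
  apply: (measurable_funM _ (measurable_cst _)).
  by apply: measurable_funD; exact: mpow.
have gE : \int[mu]_w (g w)%:E <= (c `^ p)%:E.
  rewrite (@eq_integral _ _ _ mu setT (fun w : borel X =>
    2^-1%:E * ((mdist (w : X) x `^ p)%:E + (mdist (w : X) y `^ p)%:E)));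
    last first.
    by move=> w _; rewrite -EFinD -EFinM /g [in LHS]mulrC.
  rewrite ge0_integralZl_EFin//; last 2 first.
  - by move=> w _; rewrite adde_ge0// lee_fin powR_ge0.
  - by apply: emeasurable_funD; apply/measurable_EFinP; exact: mpow.
  rewrite ge0_integralD//.
  - have -> : (c `^ p)%:E = 2^-1%:E * ((c `^ p)%:E + (c `^ p)%:E).
      by rewrite -EFinD -EFinM; congr EFin; lra.
    by rewrite lee_pmul2l// leeD.
  - by move=> w _; rewrite lee_fin powR_ge0.
  - by apply/measurable_EFinP; exact: mpow.
  - by move=> w _; rewrite lee_fin powR_ge0.
  - by apply/measurable_EFinP; exact: mpow.
have mc : \int[mu]_w (mdist (w : X) m `^ p)%:E < (c `^ p)%:E.
  apply: (lt_le_trans _ gE); apply: lt_integral_EFin => //.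
  - by rewrite (_ : _ setT = 1) ?oner_eq0//; exact: probability_setT.
  - by move=> w; exact: powR_ge0.
  - by move=> w; exact: cat0_midpoint_pow_lt.
  - by rewrite (le_lt_trans gE)// ltry.
have i0 : 0 <= \int[mu]_w (mdist (w : X) m `^ p)%:E.
  by apply: integral_ge0 => w _; rewrite lee_fin powR_ge0.
rewrite ltNge; apply/negP; rewrite dist_normE => cm.
move: mc; rewrite ltNge => /negP; apply.
rewrite -[leRHS]poweRe1// -(mulVf (lt0r_neq0 p0)) poweRrM -poweR_EFin.
apply: gt0_ler_poweR => //; rewrite ?(ltW p0)// in_itv/= leey andbT//.
exact: poweR_ge0.
Qed.

Lemma dist_norm_sublevel_closed (mu : wspace X p) c :
  closed [set y | dist_norm (sval mu) y <= c].
Proof.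
move=> y Cy /=; apply/lee_addgt0Pr => e e0.
have [z [/= zc]] := Cy _ (nbhsx_ballx y e e0).
rewrite ballEmdist/= => yz.
apply: le_trans (dist_norm_lipschitz _ y z) _.
by apply: leeD => //; rewrite lee_fin metric_sym ltW.
Qed.

(** * Existence and uniqueness of the minimizer *)

Lemma dist_norm_minimizer (mu : wspace X p) : CAT0 X -> reflexive_space X ->
  exists x, forall y, dist_norm (sval mu) x <= dist_norm (sval mu) y.
Proof.
move=> cat refl; set N := dist_norm (sval mu).
have NE x : N x = (fine (N x))%:E.
  by rewrite fineK// ge0_fin_numE ?dist_norm_lty// Lnorm_ge0.
(* The points of [X] index their own sublevel sets, larger indices having smaller [N]; a point
   common to all these sets is a minimizer. *)
have [||//|x xP] :=
  refl X (fun x y => N y <= N x) (fun x => [set y | N y <= N x]).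
- split=> [|x|x y z xy yz|x y]; [exact: (inhabits point)|exact: lexx| |].
    exact: le_trans yz xy.
  by have [xy|/ltW yx] := leP (N x) (N y); [exists x|exists y].
- move=> x; split; first by exists x => /=.
  (* The [+ 1] is there because balls are open. *)
  + exists x, (fine (N x) + fine (N x) + 1)%R => y /= yx.
    rewrite ballEmdist/= ltr_pwDr// -lee_fin EFinD -NE.
    by apply: le_trans (mdist_le_dist_norm (sval mu) x y) _; exact: leeD.
  + exact: dist_norm_sublevel_closed.
  + apply: midpoint_closed_geodesically_convex => //.
      exact: dist_norm_sublevel_closed.
    (* The strict estimate requires distinct endpoints; if they coincide, so does the midpoint. *)
    move=> y z m /= yx zx yzm; have [yz|yz] := eqVneq y z.
      rewrite -yz in yzm.
      suff <- : y = m by [].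
      by apply: (cat0_midpoint_unique yzm); rewrite mdistxx mul0r.
    rewrite (NE x); apply/ltW; apply: dist_norm_midpoint_lt yzm yz _ _.
      by rewrite -NE.
    by rewrite -NE.
- by move=> x y yx z /= /le_trans; apply.
- by exists x => y; exact: xP.
Qed.

(** The midpoint of two distinct minimizers would have a smaller value. *)
Lemma dist_norm_minimizer_unique (mu : wspace X p) x y : CAT0 X ->
  (forall z, dist_norm (sval mu) x <= dist_norm (sval mu) z) ->
  dist_norm (sval mu) y <= dist_norm (sval mu) x -> x = y.
Proof.
move=> cat xmin yx; apply/eqP/negPn/negP => xy.
have [m xym] := cat x y.
have NE : dist_norm (sval mu) x = (fine (dist_norm (sval mu) x))%:E.
  by rewrite fineK// ge0_fin_numE ?dist_norm_lty// Lnorm_ge0.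
have := xmin m; rewrite NE leNgt => /negP; apply.
by apply: dist_norm_midpoint_lt xym xy _ _; rewrite -NE.
Qed.

(** * Nearest Dirac masses and the reach *)

Lemma Unp_range_wdirac : CAT0 X -> reflexive_space X ->
  Unp (@wdist R X p) (range (@wdirac R X p)) = setT.
Proof.
move=> cat refl; apply/seteqP; split => // mu _.
have [x xmin] := dist_norm_minimizer mu cat refl.
(* The distance to the set of Dirac masses is attained at the minimizer. *)
have xdist : set_dist (@wdist R X p) mu (range (@wdirac R X p)) =
    dist_norm (sval mu) x.
  apply/le_anti/andP; split.
    apply: ereal_inf_lbound; exists (wdirac p x); first by exists x.
    exact: wdist_dirac.
  by apply: le_ereal_inf_tmp => _ [_ [y _ <-] <-]; rewrite wdist_dirac.
exists (wdirac p x); split; first by split; [exists x|rewrite wdist_dirac].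
move=> _ [[y _ <-]]; rewrite xdist wdist_dirac => xy.
by congr (wdirac p _); apply: (dist_norm_minimizer_unique cat xmin); rewrite xy.
Qed.

End distance_to_dirac.

Theorem corollary4p9 (R : realType) (X : completeMetricType R) (p : R) :
  CAT0 X -> reflexive_space X -> 1 < p ->
  reach (@wdist R X p) (range (@wdirac R X p)) = +oo%E.
Proof.
move=> cat refl p1; apply/ereal_inf_pinfty => _ [a _ <-] /=.
apply: hasNub_ereal_sup.
  (* Every nonnegative radius is admissible, so [|M| + 1] exceeds any supposed upper bound [M]. *)
  move=> [M /(_ (`|M| + 1)%R)]; rewrite Unp_range_wdirac// => MM.
  have : `|M| + 1 <= M by apply: MM; split => //; rewrite addr_ge0.
  by apply/negP; rewrite -ltNge (le_lt_trans (ler_norm M))// ltrDl.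
by exists 0; split=> //; rewrite Unp_range_wdirac.
Qed.
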